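(* For any $R\in\mathbb{R}^m$ with $R\le 0$ and any discount factor $\gamma\in[0,1)$, the set $$\mathcal{F}^I(R):=\bigcap_{i,k=1}^n\{\Delta\in\mathbb{R}^n:\ 0\ge\Delta^i\ge\gamma\Delta^k+R^j,\ \ j\in U_i\}$$ (the inequality being required for all $j\in U_i$) satisfies $\emptyset\ne\mathcal{F}^I(R)\subseteq\mathcal{A}_F(R)$ for any transition model $F$. In particular, it is the maximal model-independent feasible set in the sense that $$\mathcal{F}^I(R)=\bigcap_{F}\mathcal{A}_F(R),$$ where the intersection is over all row-stochastic matrices $F\in[0,1]^{m\times n}$. Furthermore, $$h_{\max}(R)\in\mathcal{F}^I(R)\quad\text{for all }R\le 0.$$
   Context: States are $\{1,\dots,n\}$; actions are $\{1,\dots,m\}$, partitioned into nonempty sets $U_1,\dots,U_n$ ($U_i$ = actions available in state $i$). A transition model is a row-stochastic matrix $F\in[0,1]^{m\times n}$ ($F^j_k$ = probability of moving to state $k$ under action $j$). $\gamma\in[0,1)$ is the discount factor, $R\in\mathbb{R}^m$ a reward vector. $S\in\{0,1\}^{m\times n}$ has $S^j_i=1$ iff $j\in U_i$. A policy $\pi$ selects $\pi(i)\in U_i$ for each $i$; $R_\pi$, $F_\pi$ consist of the rows of $R$, $F$ indexed by $\pi(1),\dots,\pi(n)$; the optimal value vector is $V^*_{R,F}=\max_\pi(I_n-\gamma F_\pi)^{-1}R_\pi$ (componentwise maximum, attained by an optimal policy). Vector inequalities are componentwise. For $R\le 0$ the admissible set for the model $F$ is $$\mathcal{A}_F(R):=\{\Delta\in\mathbb{R}^n:\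 R+(\gamma F-S)\Delta\le 0,\ |(V^*_{R,F})^i-\Delta^i|\le|(V^*_{R,F})^i|\ \ \forall i\}.$$ The map $h_{\max}:\mathbb{R}^m\to\mathbb{R}^n$ is $h_{\max}^i(R)=\max_{j\in U_i}R^j$. *)

(* Defs.v *)
From HB Require Import structures.
From mathcomp Require Import all_boot all_order all_algebra.
From mathcomp Require Import boolp classical_sets reals.

Set Implicit Arguments.
Unset Strict Implicit.
Unset Printing Implicit Defensive.

Import Order.TTheory GRing.Theory Num.Theory.

Local Open Scope classical_set_scope.
Local Open Scope ring_scope.

(* The first picked value seeds the iterated maximum, so that nothing outside
   {f x | x in A} takes part in it; 0 is a junk value for empty A. *)
Definition fin_max (R : realType) (I : finType) (A : {pred I}) (f : I -> R) : R :=
  if [pick x in A] is Some x0 then \big[Num.max/f x0]_(x in A) f x else 0.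

Lemma fin_max_ge (R : realType) (I : finType) (A : {pred I}) (f : I -> R) x :
  x \in A -> f x <= fin_max A f.
Proof.
rewrite /fin_max; case: pickP => [x0 _|A0] xA; last by rewrite A0 in xA.
exact: le_bigmax_cond.
Qed.

Lemma fin_max_attained (R : realType) (I : finType) (A : {pred I}) (f : I -> R) x :
  x \in A -> exists2 y, y \in A & fin_max A f = f y.
Proof.
rewrite /fin_max; case: pickP => [x0 x0A|A0] xA; last by rewrite A0 in xA.
apply: (big_ind (fun v => exists2 y, y \in A & v = f y)); first by exists x0.
  move=> _ _ [y yA ->] [z zA ->].
  by case: (leP (f y) (f z)) => _; [exists z | exists y].
by move=> y yA; exists y.
Qed.

(* States are 'I_n, actions are 'I_m, and U i is the set of actions available
   in state i. *)
Definition action_partition (m n : nat) (U : 'I_n -> {set 'I_m}) : Prop :=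
  [/\ forall i, U i != finset.set0,
      forall i k, i != k -> (U i :&: U k = finset.set0)%SET
    & (\bigcup_i U i = [set: 'I_m])%SET ].

Definition row_stochastic (R : realType) (m n : nat) : set 'M[R]_(m, n) :=
  [set F | (forall j k, 0 <= F j k <= 1) /\ (forall j, \sum_k F j k = 1)].

Definition state_action_mx (R : realType) (m n : nat) (U : 'I_n -> {set 'I_m}) :
    'M[R]_(m, n) :=
  \matrix_(j, i) (j \in U i)%:R.

Definition policies (m n : nat) (U : 'I_n -> {set 'I_m}) :
    {pred {ffun 'I_n -> 'I_m}} :=
  [pred p : {ffun 'I_n -> 'I_m} | [forall i, p i \in U i]].

(* For 0 <= gamma < 1 and F row-stochastic the matrix being inverted is
   invertible, so invmx is a genuine inverse. *)
Definition policy_value (R : realType) (m n : nat) (gamma : R)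
    (F : 'M[R]_(m, n)) (r : 'cV[R]_m) (p : {ffun 'I_n -> 'I_m}) : 'cV[R]_n :=
  invmx (1%:M - gamma *: rowsub p F) *m rowsub p r.

Definition optimal_value (R : realType) (m n : nat) (U : 'I_n -> {set 'I_m})
    (gamma : R) (F : 'M[R]_(m, n)) (r : 'cV[R]_m) : 'cV[R]_n :=
  \col_i fin_max (policies U) (fun p => policy_value gamma F r p i 0).

Definition admissible_set (R : realType) (m n : nat) (U : 'I_n -> {set 'I_m})
    (gamma : R) (F : 'M[R]_(m, n)) (r : 'cV[R]_m) : set 'cV[R]_n :=
  [set D : 'cV[R]_n |
    (forall j, (r + (gamma *: F - state_action_mx R U) *m D) j 0 <= 0) /\
    (forall i, `|optimal_value U gamma F r i 0 - D i 0|
               <= `|optimal_value U gamma F r i 0|)].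

Definition independent_set (R : realType) (m n : nat) (U : 'I_n -> {set 'I_m})
    (gamma : R) (r : 'cV[R]_m) : set 'cV[R]_n :=
  \bigcap_(i : 'I_n) \bigcap_(k : 'I_n)
    [set D : 'cV[R]_n |
      forall j, j \in U i -> 0 >= D i 0 /\ D i 0 >= gamma * D k 0 + r j 0].

Definition h_max (R : realType) (m n : nat) (U : 'I_n -> {set 'I_m})
    (r : 'cV[R]_m) : 'cV[R]_n :=
  \col_i fin_max (mem (U i)) (fun j => r j 0).

(* Main.v *)
(** Every row of [F] is a convex combination of unit vectors, so the model-independent
    constraints are exactly the feasibility constraints of the deterministic models in
    which all actions lead to one state [k]; averaging them gives the constraint for any [F].
    A maximum principle for [1 - gamma P] yields [V* <= D] from feasibility of [D], and for
    [V* <= 0] the bound [|V* - D| <= |V*|] forces [D <= 0] and follows from [V* <= D <= 0]. *)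
Require Import Defs.
From HB Require Import structures.
From mathcomp Require Import all_boot all_order all_algebra.
From mathcomp Require Import boolp classical_sets reals.
From mathcomp Require Import lra.

Set Implicit Arguments.
Unset Strict Implicit.
Unset Printing Implicit Defensive.

Import Order.TTheory GRing.Theory Num.Theory.

Local Open Scope classical_set_scope.
Local Open Scope ring_scope.

Section MaximumPrinciple.

Variables (R : realType) (n : nat) (gamma : R) (P : 'M[R]_n).
Hypotheses (hgamma : 0 <= gamma < 1) (hP : row_stochastic P).

(** At an index [i0] maximizing [x], the average [(P *m x) i0 0] is at most [x i0 0]. The hypothesis
    then gives [(1 - gamma) * x i0 0 <= 0], and [gamma < 1]. *)
Lemma discounted_max_principle (x : 'cV[R]_n) :
  (forall i, ((1%:M - gamma *: P) *m x) i 0 <= 0) -> forall i, x i 0 <= 0.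
Proof.
move=> hx i; have /andP[g0 g1] := hgamma; have [hP01 hP1] := hP.
case: (@Order.TotalTheory.arg_maxP _ _ _ i xpredT (fun k => x k 0) isT) => i0 _ hmax.
apply: (le_trans (hmax i isT)).
have hPx : (P *m x) i0 0 <= x i0 0.
  rewrite mxE -[leRHS]mul1r -(hP1 i0) mulr_suml; apply: ler_sum => k _.
  by apply: ler_wpM2l (hmax k isT); have /andP[] := hP01 i0 k.
have := hx i0; rewrite mulmxBl mul1mx -scalemxAl !mxE; rewrite mxE in hPx.
by have := ler_wpM2l g0 hPx; nra.
Qed.

(** The maximum principle applied to a kernel vector and to its opposite shows that the kernel is
    trivial. *)
Lemma discounted_unitmx : 1%:M - gamma *: P \in unitmx.
Proof.
(* [inj_row_free] tests row vectors, whereas the maximum principle concerns columns; hence the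
   transpose. *)
rewrite -unitmx_tr -row_free_unit; apply: inj_row_free => v hv.
have hx : (1%:M - gamma *: P) *m v^T = 0.
  by rewrite -[LHS]trmxK trmx_mul trmxK hv trmx0.
apply/rowP => k; rewrite mxE; apply/eqP; rewrite eq_le; apply/andP; split.
  have := @discounted_max_principle v^T _ k.
  by rewrite mxE; apply=> i; rewrite hx mxE.
have := @discounted_max_principle (- v^T) _ k.
by rewrite !mxE oppr_le0; apply=> i; rewrite mulmxN hx !mxE oppr0.
Qed.

End MaximumPrinciple.

Section PolicyValues.

Variables (R : realType) (m n : nat) (U : 'I_n -> {set 'I_m}) (gamma : R).
Variables (F : 'M[R]_(m, n)) (r : 'cV[R]_m).
Hypotheses (hU : action_partition U) (hgamma : 0 <= gamma < 1).
Hypothesis hF : row_stochastic F.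

Lemma row_stochastic_rowsub (p : {ffun 'I_n -> 'I_m}) :
  row_stochastic (rowsub p F).
Proof.
have [hF01 hF1] := hF; split=> [j k | j]; first by rewrite mxE.
by rewrite -[RHS](hF1 (p j)); apply: eq_bigr => k _; rewrite mxE.
Qed.

Lemma policy_valueK (p : {ffun 'I_n -> 'I_m}) :
  (1%:M - gamma *: rowsub p F) *m policy_value gamma F r p = rowsub p r.
Proof.
by rewrite mulKVmx // discounted_unitmx //; exact: row_stochastic_rowsub.
Qed.

(** The maximum principle is applied to the policy value minus [D]. *)
Lemma policy_value_le (p : {ffun 'I_n -> 'I_m}) (D : 'cV[R]_n) :
  (forall i, r (p i) 0 + gamma * (F *m D) (p i) 0 <= D i 0) ->
  forall i, policy_value gamma F r p i 0 <= D i 0.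
Proof.
move=> hD i; rewrite -subr_le0.
have := @discounted_max_principle _ _ _ _ hgamma (row_stochastic_rowsub p)
  (policy_value gamma F r p - D) _ i.
rewrite [(policy_value _ _ _ _ - D) i 0]mxE [(- D) i 0]mxE; apply=> k; rewrite mulmxBr policy_valueK mulmxBl mul1mx.
rewrite -scalemxAl mul_rowsub_mx !mxE.
by have := hD k; rewrite mxE; lra.
Qed.

(** Nonempty [U i] yield at least one policy, so the junk value of [fin_max] never occurs. *)
Lemma optimal_value_attained i :
  exists2 p, p \in policies U &
    optimal_value U gamma F r i 0 = policy_value gamma F r p i 0.
Proof.
have [U0 _ _] := hU.
have /fin_all_exists[f hf] : forall i, exists j, j \in U i.
  by move=> k; apply/finset.set0Pn.
rewrite mxE; apply: (@fin_max_attained _ _ _ _ (finfun f)).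
by apply/forallP => k; rewrite ffunE.
Qed.

Lemma optimal_value_le (D : 'cV[R]_n) :
  (forall i j, j \in U i -> r j 0 + gamma * (F *m D) j 0 <= D i 0) ->
  forall i, optimal_value U gamma F r i 0 <= D i 0.
Proof.
move=> hD i; have [p /forallP hp ->] := optimal_value_attained i.
by apply: policy_value_le => k; apply: hD.
Qed.

Lemma optimal_value_le0 (hr : forall j, r j 0 <= 0) i :
  optimal_value U gamma F r i 0 <= 0.
Proof.
have := @optimal_value_le 0 _ i; rewrite [(0 : 'cV_n) i 0]mxE; apply=> k j _.
by rewrite mulmx0 !mxE mulr0 addr0.
Qed.

End PolicyValues.

Section FeasibleSets.

Variables (R : realType) (m n : nat) (U : 'I_n -> {set 'I_m}) (gamma : R).
Variable r : 'cV[R]_m.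
Hypotheses (hU : action_partition U) (hgamma : 0 <= gamma < 1).
Hypothesis hr : forall j, r j 0 <= 0.

(** Disjointness leaves a single nonzero entry, in column [i], in row [j] of the state-action
    matrix. *)
Lemma feasibility_entry (F : 'M[R]_(m, n)) (D : 'cV[R]_n) i j : j \in U i ->
  (r + (gamma *: F - state_action_mx R U) *m D) j 0 =
  r j 0 + gamma * (F *m D) j 0 - D i 0.
Proof.
move=> ji; have [_ dU _] := hU.
have hS : (state_action_mx R U *m D) j 0 = D i 0.
  rewrite mxE (bigD1 i) //= mxE ji mul1r big1 ?addr0 // => k ki.
  rewrite mxE; have /setP/(_ j) := dU k i ki; rewrite !inE ji andbT => ->.
  by rewrite mul0r.
by rewrite mulmxBl -scalemxAl -hS !mxE addrA.
Qed.

Lemma independent_setP (D : 'cV[R]_n) :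
  independent_set U gamma r D <->
  (forall i, D i 0 <= 0) /\
  (forall i k j, j \in U i -> r j 0 + gamma * D k 0 <= D i 0).
Proof.
have [U0 _ _] := hU; split=> [hD | [hD0 hD] i _ k _ j ji].
  split=> [i | i k j ji].
    by have /finset.set0Pn[j ji] := U0 i; have [] := hD i I i I j ji.
  by rewrite addrC; have [] := hD i I k I j ji.
by split; rewrite // addrC; apply: hD.
Qed.

Lemma independent_set_sub_admissible (F : 'M[R]_(m, n)) : row_stochastic F ->
  independent_set U gamma r `<=` admissible_set U gamma F r.
Proof.
move=> hF D /independent_setP[hD0 hD]; have [_ _ cU] := hU.
have hFD i j : j \in U i -> r j 0 + gamma * (F *m D) j 0 <= D i 0.
  move=> ji; have [hF01 hF1] := hF.
  (* Since row [j] of [F] sums to 1, both [r j 0] and [D i 0] become [F]-weighted sums, to be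
     compared term by term. *)
  rewrite mxE mulr_sumr -[r j 0]mul1r -[leRHS]mul1r -(hF1 j) !mulr_suml.
  rewrite -big_split /=; apply: ler_sum => k _; rewrite mulrCA -mulrDr.
  by apply: ler_wpM2l (hD i k j ji); have /andP[] := hF01 j k.
split=> [j | i].
  have : j \in (\bigcup_i U i)%SET by rewrite cU inE.
  by case/finset.bigcupP => i _ ji; rewrite (feasibility_entry _ _ ji) subr_le0 hFD.
have V0 := optimal_value_le0 hU hgamma hF hr i.
have VD := optimal_value_le hU hgamma hF hFD i.
by rewrite distrC (ger0_norm (_ : 0 <= _ - _)) ?subr_ge0 // ler0_norm // gerDr.
Qed.

Lemma row_stochastic_to_state (k : 'I_n) :
  row_stochastic (\matrix_(j < m, l < n) (l == k)%:R : 'M[R]_(m, n)).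
Proof.
split=> [j l | j]; first by rewrite mxE; case: eqP; rewrite ?ler01 ?lexx.
rewrite (bigD1 k) //= mxE eqxx big1 ?addr0 // => l /negPf lk.
by rewrite mxE lk.
Qed.

Lemma bigcap_admissible_sub_independent :
  \bigcap_(F in @row_stochastic R m n) admissible_set U gamma F r
    `<=` independent_set U gamma r.
Proof.
move=> D hD; apply/independent_setP; split=> [i | i k j ji].
  (* One stochastic model suffices for the sign: as [V* <= 0], its bound gives [D - V* <= -V*]. *)
  have hF := row_stochastic_to_state i.
  have [_ /(_ i)] := hD _ hF.
  rewrite distrC (ler0_norm (optimal_value_le0 hU hgamma hF hr i)).
  by move/(le_trans (ler_norm _)); rewrite gerDr.
(* When every action leads to [k], [F *m D] is constantly [D k 0]. *)
have [/(_ j) + _] := hD _ (row_stochastic_to_state k).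
rewrite (feasibility_entry _ _ ji) subr_le0 mxE (bigD1 k) //= mxE eqxx mul1r.
by rewrite big1 ?addr0 // => l /negPf lk; rewrite mxE lk mul0r.
Qed.

(** The entries of [h_max U r] are nonpositive, so adding [gamma] times one of them to [r j 0]
    cannot exceed [r j 0], which is at most the maximum over [U i]. *)
Lemma h_max_independent : independent_set U gamma r (h_max U r).
Proof.
have [U0 _ _] := hU; have /andP[g0 _] := hgamma.
have h0 i : h_max U r i 0 <= 0.
  have /finset.set0Pn[j ji] := U0 i; rewrite mxE.
  by have [l _ ->] := @fin_max_attained R _ (mem (U i)) (fun j => r j 0) j ji.
apply/independent_setP; split=> // i k j ji.
apply: (@le_trans _ _ (r j 0)); first by rewrite gerDl mulr_ge0_le0.
by rewrite [leRHS]mxE; apply: (@fin_max_ge R _ _ (fun j => r j 0)).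
Qed.

End FeasibleSets.

Theorem theorem33 (R : realType) (m n : nat) (U : 'I_n -> {set 'I_m})
  (hU : action_partition U) (gamma : R) (hgamma : 0 <= gamma < 1)
  (r : 'cV[R]_m) (hr : forall j, r j 0 <= 0) :
  [/\ independent_set U gamma r !=set0,
      forall F : 'M[R]_(m, n), row_stochastic F ->
        independent_set U gamma r `<=` admissible_set U gamma F r,
      independent_set U gamma r =
        \bigcap_(F in @row_stochastic R m n) admissible_set U gamma F r
    & independent_set U gamma r (h_max U r)].
Proof.
have hh := h_max_independent hU hgamma hr.
split=> //; first by exists (h_max U r).
  by move=> F; apply: independent_set_sub_admissible.
apply/seteqP; split; last exact: bigcap_admissible_sub_independent.
by move=> D hD F hF; apply: independent_set_sub_admissible hD.
Qed.
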